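(* Let $n\ge2$ and let $X_{\cdot,B}$ be a simple (undirected, loopless) quantum graph on $M_n$, i.e. $B\in M_n$ is a real symmetric projector with $B\mathbf 1=0$. Then $$\alpha(X_{\cdot,B})\ \ge\ 1+\left\lfloor\frac{n-1}{\operatorname{rk}B+1}\right\rfloor.$$
   Context: $M_n=M_n(\mathbb C)$; ''projector'' means orthogonal projector; $\mathbf 1\in\mathbb C^n$ is the all-ones vector. $X_{\cdot,B}$ is the quantum graph on $M_n$ with adjacency operator the Schur multiplier $x\mapsto (B_{ij}x_{ij})_{i,j}$; its operator space is $S=\{\operatorname{diag}(v): v\in\operatorname{img}B\}\subseteq M_n$. A $k$-independent set of a quantum graph with operator space $S$ is a projector $P\in M_n$ of rank $k$ with $PSP\subseteq\mathbb CP$; the independence number $\alpha$ is the largest $k$ for which a $k$-independent set exists. *)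

(* Defs.v *)
From HB Require Import structures.
From mathcomp Require Import all_boot all_order all_algebra.
From mathcomp Require Import boolp classical_sets reals.
From mathcomp Require Export complex.

Set Implicit Arguments.
Unset Strict Implicit.
Unset Printing Implicit Defensive.

Import Order.TTheory GRing.Theory Num.Theory.
Local Open Scope ring_scope.
Local Open Scope classical_set_scope.

Section QuantumGraphs.
Context {C : numClosedFieldType} {n : nat}.
Implicit Types (B P X y : 'M[C]_n) (S : set 'M[C]_n) (k : nat).

Definition projector P : Prop := P \is hermsymmx /\ P *m P = P.

Definition schur_mult B X : 'M[C]_n := \matrix_(i, j) (B i j * X i j).

(* B is identified with the quantum graph X_{.,B}, whose adjacency operator is
   [schur_mult B]. *)
Definition simple_schur_graph B : Prop :=
  [/\ projector B, B \is a realmx, B \is symmetricmx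
    & B *m (const_mx 1 : 'cV_n) = 0].

(* img B is the column space {B u : u in C^n}; the transpose is only there
   because [diag_mx] takes a row. *)
Definition schur_opspace B : set 'M[C]_n :=
  [set diag_mx (B *m u)^T | u in [set: 'cV[C]_n]].

(* The operator space attached to an adjacency operator A with Kraus operators
   K_r, A x = sum_r K_r x K_r^*, is the span of the K_r, i.e. the range of
   y |-> sum_ij A(e_ij) y e_ji = sum_r tr(K_r^* y) K_r.  For A = schur_mult B
   this range is schur_opspace B. *)
Lemma schur_opspaceE B :
  schur_opspace B =
  [set \sum_i \sum_j schur_mult B (delta_mx i j) *m y *m delta_mx j i
     | y in [set: 'M[C]_n]].
Proof.
have E y : \sum_i \sum_j schur_mult B (delta_mx i j) *m y *m delta_mx j i
           = diag_mx (B *m \col_j y j j)^T.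
  have entry i j : schur_mult B (delta_mx i j) *m y *m delta_mx j i
                   = (B i j * y j j) *: delta_mx i i.
    have -> : schur_mult B (delta_mx i j) = B i j *: delta_mx i j.
      apply/matrixP=> a b; rewrite !mxE.
      by case: eqP => [->|]; case: eqP => [->|] //=; rewrite !mulr0.
    rewrite -scalemxAl -scalemxAl -scalerA; congr (_ *: _).
    apply/matrixP=> a b; rewrite !mxE (bigD1 j) //= big1 ?addr0; last first.
      by move=> l lj; rewrite !mxE (negbTE lj) mulr0.
    rewrite !mxE (bigD1 j) //= big1 ?addr0; last first.
      by move=> l lj; rewrite !mxE (negbTE lj) andbF mul0r.
    rewrite !mxE !eqxx andbT /=.
    by case: (a == i); case: (b == i); rewrite /= ?mul0r ?mulr0 ?mul1r ?mulr1.
  rewrite diag_mx_sum_delta; apply: eq_bigr => i _.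
  under eq_bigr do rewrite entry.
  rewrite -scaler_suml !mxE; congr (_ *: _).
  by apply: eq_bigr => j _; rewrite mxE.
apply/seteqP; split=> [_ [u _ <-]|_ [y _ <-]] /=.
  exists (diag_mx u^T) => //; rewrite E; congr (diag_mx (B *m _)^T).
  by apply/colP=> j; rewrite !mxE eqxx.
by exists (\col_j y j j) => //; rewrite E.
Qed.

Definition independent S k P : Prop :=
  [/\ projector P, \rank P = k
    & forall X, S X -> exists c : C, P *m X *m P = c *: P].

(* The range k <= n is no restriction, since \rank P <= n. *)
Definition independence_number S : nat :=
  \max_(k < n.+1 | `[< exists P, independent S k P >]) k.

Lemma independent_le S k P : independent S k P -> (k <= independence_number S)%N.
Proof.
move=> iP; have kn : (k < n.+1)%N by case: iP => _ <- _; exact: rank_leq_row.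
apply: (@leq_bigmax_cond _ _ _ (Ordinal kn)); apply/asboolP; exact: ex_intro iP.
Qed.

Lemma independence_numberP S :
  exists P, independent S (independence_number S) P.
Proof.
have i0 : independent S 0 0.
  split; [split | exact: mxrank0 | move=> X _].
  - by apply/is_hermitianmxP; rewrite trmx0 map_mx0 scaler0.
  - by rewrite mul0mx.
  - by exists 0; rewrite !mul0mx scale0r.
have c0 : (0 < #|[pred k : 'I_n.+1 | `[< exists P, independent S k P >]]|)%N.
  by apply/card_gt0P; exists ord0; apply/asboolP; exact: ex_intro i0.
have [k /asboolP iP maxE] := eq_bigmax_cond (fun k : 'I_n.+1 => k : nat) c0.
have -> : independence_number S = k by exact: maxE.
exact: iP.
Qed.

End QuantumGraphs.

(* Main.v *)
(* The rows of a real column basis of B are n points in R^d, d = rk B.  By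
   Tverberg's theorem, n > (d + 1) k such points split into k + 1 classes whose
   convex hulls share a point z.  Let l be the convex weights and
   psi_a = sum_{i in class a} sqrt(l_i) e_i.  These vectors are orthonormal with
   disjoint supports, and every v in img B is a linear function of the points,
   so <psi_a, diag(v) psi_a> is the value of that function at z, for every a.
   The projector onto the span of the psi_a is thus (k + 1)-independent.

   Tverberg's theorem is derived by Sarkaria's tensor trick from Barany's
   colorful Caratheodory theorem, which in turn is proved by minimizing the
   distance to the origin over all rainbow simplices. *)
Require Import Defs.
From mathcomp Require Import all_boot all_order all_algebra.
From mathcomp Require Import boolp classical_sets reals complex.
From mathcomp Require Import topology normedtype derive.
From mathcomp Require Import ring lra.

Import Order.TTheory GRing.Theory Num.Theory.
Import numFieldNormedType.Exports.
Set Implicit Arguments.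
Unset Strict Implicit.

Local Open Scope ring_scope.

(** * Inner products and convex weights *)

Definition dot (R : realFieldType) (N : nat) (u v : 'rV[R]_N) : R :=
  (u *m v^T) 0 0.

Definition simplex (R : realFieldType) (m : nat) (l : 'rV[R]_m) : Prop :=
  (forall i, 0 <= l 0 i) /\ \sum_i l 0 i = 1.

Section Dot.
Context {R : realFieldType} {N : nat}.
Implicit Types u v w p : 'rV[R]_N.

Lemma dotE u v : dot u v = \sum_i u 0 i * v 0 i.
Proof. by rewrite /dot mxE; apply: eq_bigr => i _; rewrite mxE. Qed.

Lemma dotC u v : dot u v = dot v u.
Proof. by rewrite !dotE; apply: eq_bigr => i _; rewrite mulrC. Qed.

Lemma dotDl u v w : dot (u + v) w = dot u w + dot v w.
Proof. by rewrite /dot mulmxDl mxE. Qed.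

Lemma dotZl a u v : dot (a *: u) v = a * dot u v.
Proof. by rewrite /dot -scalemxAl mxE. Qed.

Lemma dot0l v : dot 0 v = 0.
Proof. by rewrite /dot mul0mx mxE. Qed.

Lemma dot_suml (I : finType) (F : I -> 'rV[R]_N) v :
  dot (\sum_i F i) v = \sum_i dot (F i) v.
Proof. by rewrite /dot mulmx_suml summxE. Qed.

Lemma dot_ge0 u : 0 <= dot u u.
Proof. by rewrite dotE sumr_ge0 // => i _; rewrite -expr2 sqr_ge0. Qed.

Lemma dot_gt0 u : u != 0 -> 0 < dot u u.
Proof.
move=> u0; rewrite lt_def dot_ge0 andbT; apply: contra u0.
rewrite dotE psumr_eq0 => [/allP z|i _]; last by rewrite -expr2 sqr_ge0.
apply/eqP/rowP=> i; rewrite mxE; apply/eqP.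
by have := z i (mem_index_enum _); rewrite mulf_eq0 orbb.
Qed.

(* The quadratic t |-> |p + t (w - p)|^2 has slope 2 (<w, p> - <p, p>) at 0; if
   that were negative, the t chosen below would give a smaller value. *)
Lemma segment_min_dot p w :
  (forall t, 0 <= t <= 1 ->
     dot p p <= dot (p + t *: (w - p)) (p + t *: (w - p))) ->
  dot p p <= dot w p.
Proof.
move=> pmin; set d := w - p.
have -> : w = p + d by rewrite /d addrC subrK.
rewrite dotDl lerDl leNgt; apply/negP=> dp0.
have dd0 := dot_ge0 d.
set s := dot d d - dot d p.
have s0 : 0 < s by rewrite /s; lra.
have s1 : 0 <= - dot d p / s <= 1.
  by rewrite divr_ge0 ?ler_pdivrMr ?mul1r ?(ltW s0) //=; rewrite /s; lra.
have := pmin _ s1; rewrite -/d; set t := _ / s.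
rewrite dotDl (dotC p) (dotC (t *: d)) !dotDl !dotZl.
rewrite (dotC p (t *: d)) dotZl (dotC d (t *: d)) dotZl.
have tE : t * s = - dot d p by rewrite /t divfK ?gt_eqF.
have t0 : 0 < t by rewrite /t divr_gt0 // oppr_gt0.
rewrite /s in tE; nra.
Qed.

End Dot.

Lemma simplex_delta (R : realFieldType) (m : nat) (i : 'I_m) :
  simplex (delta_mx 0 i : 'rV[R]_m).
Proof.
split=> [j|]; first by rewrite mxE ler0n.
rewrite (bigD1 i) //= big1 => [|j /negPf ji]; rewrite mxE ?eqxx ?addr0 //.
by rewrite ji.
Qed.

Lemma simplex_segment (R : realFieldType) (m : nat) (l l' : 'rV[R]_m) (t : R) :
  0 <= t <= 1 -> simplex l -> simplex l' -> simplex (l + t *: (l' - l)).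
Proof.
move=> /andP[t0 t1] [l0 l1] [l'0 l'1]; split=> [i|].
  by have := l0 i; have := l'0 i; rewrite !mxE; nra.
under eq_bigr do rewrite !mxE.
by rewrite big_split /= -mulr_sumr sumrB l1 l'1 subrr mulr0 addr0.
Qed.

(** * Points of a convex hull nearest to the origin *)

Definition simplex_argmin (R : realFieldType) (m N : nat) (W : 'M[R]_(m, N))
    (l : 'rV[R]_m) : Prop :=
  simplex l /\ forall l', simplex l' ->
    dot (l *m W) (l *m W) <= dot (l' *m W) (l' *m W).

Lemma simplex_argmin_exists (R : realType) (m N : nat) (W : 'M[R]_(m.+1, N)) :
  exists l, simplex_argmin W l.
Proof.
have sum_cont (I : finType) (F : I -> 'rV[R]_m.+1 -> R) :
    (forall i, continuous (F i)) -> continuous (fun l => \sum_i F i l).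
  by move=> Fc; apply: continuous_big => // ?; exact: add_continuous.
pose A : set 'rV[R]_m.+1 := [set l | simplex l]%classic.
have A0 : (A !=set0)%classic by exists (delta_mx 0 ord0); exact: simplex_delta.
(* Nonnegative weights of sum 1 are at most 1, so the simplex is a closed subset of a compact
   cube. *)
have AE : A = ([set l : 'rV[R]_m.+1 | forall i, `[0, 1]%classic (l ord0 i)]
    `&` (fun l : 'rV[R]_m.+1 => \sum_i l 0 i) @^-1` [set x | x = 1])%classic.
  apply/seteqP; split=> l /= [l0 l1]; split=> // i; last first.
    by have /andP[] := l0 i.
  rewrite in_itv /= l0 -l1 (bigD1 i) //= lerDl.
  by apply: sumr_ge0 => j _; exact: l0.
have Aco : compact A.
  rewrite AE; apply: compact_closedI.
    apply: (@rV_compact R m.+1 (fun=> `[0, 1]%classic)) => _.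
    exact: segment_compact.
  apply: preimage_closed; last exact: closed_eq.
  move=> l _; apply: sum_cont => i; exact: coord_continuous.
pose f (l : 'rV[R]_m.+1) := dot (l *m W) (l *m W).
have fc : continuous f.
  have -> : f = fun l => \sum_j (\sum_i l 0 i * W i j) * (\sum_i l 0 i * W i j).
    apply: funext => l; rewrite /f dotE.
    by apply: eq_bigr => j _; rewrite !mxE.
  have c j : continuous (fun l : 'rV[R]_m.+1 => \sum_i l 0 i * W i j).
    apply: sum_cont => i l.
    apply: (@continuousM R 'rV[R]_m.+1 (fun l => l 0 i) (fun=> W i j) l).
      exact: coord_continuous.
    exact: cst_continuous.
  apply: sum_cont => j l.
  by apply: (@continuousM R 'rV[R]_m.+1); exact: c.
have [l lA lmin] := EVT_min_rV A0 Aco (continuous_subspaceT fc).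
exists l; split; first by move: lA; rewrite inE.
by move=> l' l'A; apply: lmin; rewrite inE.
Qed.

Section SimplexArgmin.
Context {R : realFieldType} {m N : nat} {W : 'M[R]_(m, N)} {l : 'rV[R]_m}.
Hypothesis lmin : simplex_argmin W l.
Let p := l *m W.

Lemma simplex_argmin_dot i : dot p p <= dot (row i W) p.
Proof.
apply: segment_min_dot => t t01.
have := lmin.2 _ (simplex_segment t01 lmin.1 (simplex_delta R i)).
by rewrite mulmxDl -scalemxAl mulmxBl -rowE.
Qed.

(* If all weights are positive, every row of W lies in the hyperplane
   <., p> = <p, p>, so a linear dependence of the rows is an affine one: moving
   along it keeps p fixed until some weight vanishes. *)
Lemma simplex_argmin_facet : (N < m)%N -> p != 0 ->
  exists l' i, [/\ simplex l', l' *m W = p & l' 0 i = 0].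
Proof.
move=> Nm p0; have pp0 := dot_gt0 p0; have [[l0 l1] _] := lmin.
case: (boolP [exists i, l 0 i == 0]) => [/existsP[i /eqP li]|].
  by exists l, i.
rewrite negb_exists => /forallP li0.
have {li0} lpos i : 0 < l 0 i by rewrite lt_def li0 l0.
have Wp i : dot (row i W) p = dot p p.
  have : \sum_i l 0 i * (dot (row i W) p - dot p p) == 0.
    under eq_bigr do rewrite mulrBr.
    rewrite sumrB -mulr_suml l1 mul1r {2}/p mulmx_sum_row dot_suml.
    by under [X in _ - X]eq_bigr do rewrite dotZl; rewrite subrr.
  rewrite psumr_eq0 => [/allP/(_ i (mem_index_enum _))|j _].
    by rewrite mulf_eq0 gt_eqF //= subr_eq0 => /eqP.
  by rewrite mulr_ge0 // subr_ge0 simplex_argmin_dot.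
have : kermx W != 0.
  rewrite -mxrank_eq0 mxrank_ker subn_eq0 -ltnNge.
  exact: leq_ltn_trans (rank_leq_col W) Nm.
case/rowV0Pn => u /sub_kermxP uW u0.
have us : \sum_i u 0 i = 0.
  apply: (mulIf (lt0r_neq0 pp0)); rewrite mul0r.
  rewrite -[RHS](dot0l p) -uW mulmx_sum_row dot_suml mulr_suml.
  by apply: eq_bigr => i _; rewrite dotZl Wp.
have [i0 ui0] : exists i, u 0 i < 0.
  apply/existsP; apply: contraNT u0; rewrite negb_exists => /forallP u_ge0.
  apply/eqP/rowP=> i; rewrite mxE; apply/eqP; move/eqP: us.
  rewrite psumr_eq0 => [/allP/(_ i (mem_index_enum _)) //|j _].
  by rewrite leNgt.
(* The least ratio [q i] over the negative entries of [u] is the longest step along [u] that keeps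
   all weights nonnegative; it kills weight [i]. *)
pose q i := l 0 i / - u 0 i.
case: (@arg_minP _ _ _ i0 (fun i => u 0 i < 0) q ui0) => i ui qmin.
have qi0 : 0 <= q i by rewrite divr_ge0 ?oppr_ge0 // ltW.
exists (l + q i *: u), i; split.
- split=> [j|]; last first.
    under eq_bigr do rewrite !mxE.
    by rewrite big_split /= -mulr_sumr us mulr0 addr0.
  rewrite !mxE; have [uj|uj] := leP 0 (u 0 j).
    by rewrite addr_ge0 // mulr_ge0.
  have := qmin _ uj; rewrite {2}/q ler_pdivlMr ?oppr_gt0 //; lra.
- by rewrite mulmxDl -scalemxAl uW scaler0 addr0.
- by rewrite !mxE /q; field; rewrite lt_eqF.
Qed.

End SimplexArgmin.

(** * Colorful Caratheodory theorem *)

(* At an optimal choice with p <> 0 some color i has weight 0; recoloring i by a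
   j with <w i j, p> <= 0 keeps p optimal, against the first-order condition. *)
Lemma colorful_caratheodory (R : realType) (N m k : nat)
  (w : 'I_m -> 'I_k.+1 -> 'rV[R]_N) :
  (N < m)%N -> (forall i, \sum_j w i j = 0) ->
  exists (c : {ffun 'I_m -> 'I_k.+1}) (l : 'rV[R]_m),
    simplex l /\ \sum_i l 0 i *: w i (c i) = 0.
Proof.
case: m w => // m w Nm w0.
pose W (c : {ffun 'I_m.+1 -> 'I_k.+1}) := \matrix_i w i (c i).
have [L Lmin] := choice (fun c => simplex_argmin_exists (W c)).
pose p c := L c *m W c.
case: (@arg_minP _ _ _ [ffun=> ord0] xpredT (fun c => dot (p c) (p c)) isT).
move=> c _ cmin; have [pc|pc] := eqVneq (p c) 0.
  exists c, (L c); split; first by case: (Lmin c).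
  by rewrite -[RHS]pc /p mulmx_sum_row; apply: eq_bigr => i _; rewrite rowK.
have [l [i [ls lW li]]] := simplex_argmin_facet (Lmin c) Nm pc.
have [j wj] : exists j, dot (w i j) (p c) <= 0.
  apply/existsP; apply: contraT; rewrite negb_exists => /forallP wpos.
  have : 0 < \sum_j dot (w i j) (p c).
    rewrite (bigD1 ord0) //= ltr_wpDr ?ltNge ?wpos // sumr_ge0 // => j _.
    by rewrite ltW // ltNge.
  by rewrite -dot_suml w0 dot0l ltxx.
pose c' : {ffun 'I_m.+1 -> 'I_k.+1} := [ffun i' => if i' == i then j else c i'].
have lW' : l *m W c' = p c.
  rewrite -[RHS]lW !mulmx_sum_row; apply: eq_bigr => i' _; rewrite !rowK ffunE.
  by case: eqP => // ->; rewrite li !scale0r.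
(* The hull for [c'] still contains [p c], and by the choice of [c] no rainbow hull comes nearer to
   the origin. *)
have lmin : simplex_argmin (W c') l.
  split=> // l' l's; rewrite lW'; apply: le_trans (cmin c' isT) _.
  by have [_] := Lmin c'; exact.
have := simplex_argmin_dot lmin i.
by rewrite lW' rowK ffunE eqxx leNgt (le_lt_trans wj) ?dot_gt0.
Qed.

(** * Tverberg's theorem *)

Lemma tverberg (R : realType) (d m k : nat) (x : 'I_m -> 'rV[R]_d) :
  ((d + 1) * k < m)%N ->
  exists (c : 'I_m -> 'I_k.+1) (l : 'I_m -> R) (z : 'rV[R]_d),
    [/\ forall i, 0 <= l i,
        forall a, \sum_(i | c i == a) l i = 1
      & forall a, \sum_(i | c i == a) l i *: x i = z].
Proof.
(* The extra coordinate 1 makes [S a] below record the total weight of class [a] too. *)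
move=> dkm; pose X i : 'rV[R]_(d + 1) := row_mx (x i) 1.
(* The only linear dependence of the k + 1 vectors v j is sum_j v j = 0. *)
pose v (j : 'I_k.+1) : 'rV[R]_k :=
  \row_l ((j == lift ord0 l)%:R - (j == ord0)%:R).
have v0 : \sum_j v j = 0.
  have pick1 (a : 'I_k.+1) : \sum_j (j == a)%:R = 1 :> R.
    by rewrite (bigD1 a) //= eqxx big1 ?addr0 // => j /negPf ->.
  apply/rowP=> t; rewrite summxE mxE.
  by under eq_bigr do rewrite mxE; rewrite sumrB !pick1 subrr.
(* Sarkaria's tensors: choosing the color [j] for [i] puts point [i] into class [j]. *)
pose w i j := mxvec ((X i)^T *m v j).
have [|c [l [[l0 l1] lw]]] := @colorful_caratheodory _ _ _ _ w dkm.
  by move=> i; rewrite /w -linear_sum -mulmx_sumr v0 mulmx0 linear0.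
pose S a := \sum_(i | c i == a) l 0 i *: X i.
have Sentry a b : S a 0 b = \sum_i l 0 i * X i 0 b * (c i == a)%:R.
  rewrite summxE big_mkcond; apply: eq_bigr => i _.
  by case: eqP => _; rewrite ?mxE ?mulr1 ?mulr0.
(* Entry [(b, t)] of the vanishing tensor combination is the difference of the [b]-th coordinates of
   [S (lift ord0 t)] and [S ord0]. *)
have SE a : S a = S ord0.
  case: (unliftP ord0 a) => [t ->|->//]; apply/rowP=> b; apply/eqP.
  rewrite -subr_eq0 !Sentry -sumrB.
  have /(congr1 (fun M => (vec_mx M) b t)) := lw.
  rewrite linear0 [RHS]mxE linear_sum summxE => lwbt.
  apply/eqP; rewrite -[RHS]lwbt; apply: eq_bigr => i _.
  rewrite [in RHS]linearZ /= mxvecK [RHS]mxE [(_ *m _) _ _]mxE big_ord1.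
  by rewrite [(_^T) _ _]mxE [v _ _ _]mxE; ring.
pose e : 'I_(d + 1) := rshift d ord0.
have Xe i : X i 0 e = 1 by rewrite row_mxEr mxE eqxx.
have Se a : S a 0 e = \sum_(i | c i == a) l 0 i.
  by rewrite summxE; apply: eq_bigr => i _; rewrite mxE Xe mulr1.
(* The [k.+1] classes have equal weights of total 1, whence the rescaling by [k.+1]. *)
have S0 : S ord0 0 e *+ k.+1 = 1.
  rewrite -l1 (partition_big c xpredT) //=.
  under eq_bigr do rewrite -Se SE.
  by rewrite sumr_const card_ord.
exists c, (fun i => l 0 i *+ k.+1), (lsubmx (S ord0) *+ k.+1); split.
- by move=> i; rewrite mulrn_wge0.
- by move=> a; rewrite sumrMnl -Se SE.
- move=> a; rewrite -(SE a) /S linear_sum -sumrMnl; apply: eq_bigr => i _.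
  by rewrite linearZ /= row_mxKl scalerMnl.
Qed.

(** * From Tverberg partitions to independent sets *)

Lemma real_mxP (R : realType) (m n : nat) (A : 'M[R[i]]_(m, n)) :
  A \is a mxOver Num.real -> exists A', A = map_mx (real_complex R) A'.
Proof.
move=> /mxOverP Ar; exists (map_mx (@complex.Re R) A); apply/matrixP=> i j.
by rewrite !mxE RRe_real.
Qed.

(** For real [V] the transpose is the adjoint. With P = V V^T, PXP = V (V^T X V) V^T = cP, and V^T P
    V = 1 forces rank [k]. *)
Lemma isometry_independent (C : numClosedFieldType) (n k : nat)
    (S : set 'M[C]_n) (V : 'M[C]_(n, k)) :
  V^T *m V = 1%:M -> V \is a mxOver Num.real ->
  (forall X, S X -> exists c, V^T *m X *m V = c%:M) ->
  independent S k (V *m V^T).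
Proof.
move=> VV Vr SV.
have VVV : V^T *m (V *m V^T) *m V = 1%:M by rewrite mulmxA VV mul1mx VV.
split.
- split; last by rewrite mulmxA -(mulmxA V) VV mulmx1.
  apply: realsym_hermsym.
    by apply/is_hermitianmxP; rewrite expr0 scale1r map_mx_id // trmx_mul trmxK.
  apply/mxOverP=> i j; rewrite mxE; apply: rpred_sum => l _.
  by rewrite rpredM ?mxE //; exact: (mxOverP Vr).
- apply/eqP; rewrite eqn_leq; apply/andP; split.
    exact: leq_trans (mxrankM_maxl _ _) (rank_leq_col _).
  rewrite -{1}(mxrank1 C k) -VVV.
  exact: leq_trans (mxrankM_maxl _ _) (mxrankM_maxr _ _).
move=> X /SV[c cE]; exists c.
rewrite -!mulmxA (mulmxA V^T) (mulmxA _ V) cE mul_scalar_mx.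
by rewrite -scalemxAr.
Qed.

Theorem proposition4p32 (R : realType) (n : nat) (B : 'M[R[i]]_n) :
  (2 <= n)%N ->
  simple_schur_graph B ->
  (1 + (n - 1) %/ (\rank B + 1) <= independence_number (schur_opspace B))%N.
Proof.
move=> n2 [_ /real_mxP[A ->] _ _]; rewrite mxrank_map add1n.
set k := (_ %/ _)%N; have dkn : ((\rank A + 1) * k < n)%N.
  rewrite mulnC (leq_ltn_trans (leq_divM _ _)) //.
  by rewrite subn1 prednK // ltnW.
have [c [l [z [l0 l1 lz]]]] := tverberg (fun i => row i (col_base A)) dkn.
pose V : 'M[R[i]]_(n, k.+1) :=
  \matrix_(i, a) if c i == a then (Num.sqrt (l i))%:C%C else 0.
(* Off-diagonal entries vanish because the columns of [V] have disjoint supports. Constant [D] will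
   give V^T V = 1. *)
have VDV (D : 'rV[R[i]]_n) :
    V^T *m diag_mx D *m V =
    diag_mx (\row_a \sum_(i | c i == a) (l i)%:C%C * D 0 i).
  apply/matrixP=> a b; rewrite !mxE.
  under eq_bigr do rewrite mul_mx_diag !mxE.
  have [<-|ab] := eqVneq a b; last first.
    rewrite mulr0n big1 // => i _.
    by have [ca|_] := eqVneq (c i) a; rewrite ?ca ?(negPf ab) ?mulr0 ?mul0r.
  rewrite mulr1n [RHS]big_mkcond; apply: eq_bigr => i _.
  case: eqP => _; last by rewrite mulr0.
  by rewrite mulrAC -rmorphM -expr2 sqr_sqrtr.
apply: (@independent_le _ _ _ _ (V *m V^T)); apply: isometry_independent.
- have := VDV (const_mx 1); rewrite diag_const_mx mulmx1 => ->.
  apply/matrixP=> a b; rewrite !mxE.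
  under eq_bigr do rewrite mxE mulr1.
  by rewrite -rmorph_sum l1.
- apply/mxOverP=> i a; rewrite mxE; case: ifP => _; last exact: rpred0.
  by apply/complex_realP; exists (Num.sqrt (l i)).
- move=> _ [u _ <-].
  (* As A = [col_base A *m row_base A], entry [i] of A u is the linear functional [row_base A *m u]
     at point [i]; [zu] is its value at the common point [z]. *)
  pose zu := map_mx (real_complex R) z *m
    (map_mx (real_complex R) (row_base A) *m u).
  exists (zu 0 0); rewrite VDV -diag_const_mx; congr diag_mx.
  apply/rowP=> a; rewrite [LHS]mxE [RHS]mxE.
  rewrite -{1}(mulmx_base A) map_mxM -mulmxA.
  rewrite /zu -(lz a) map_mx_sum mulmx_suml summxE.
  apply: eq_bigr => i _; rewrite map_mxZ -scalemxAl !mxE; congr (_ * _).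
  by apply: eq_bigr => j _; rewrite !mxE.
Qed.
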